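(* Let $N$ be a finite ground set with $n=|N|$, let $f:2^N\to\mathbb{R}$ be non-negative, symmetric and submodular, accessed through a value oracle, and let $k\in\mathbb{N}_+$. Consider the algorithm \textsc{Greedy-Cardinality}: set $S_0=\emptyset$; for $i=1,\dots,k$, choose $u_i\in\arg\max_{u\in N} f(u\mid S_{i-1})$, set $S_i\gets S_{i-1}+u_i$, then set $S_i\gets\textsc{Delete}(S_i)$; return $S_k$. Then this algorithm has an approximation ratio of $\frac{1}{2}(1-e^{-2})$ for the problem $\max\{f(S): S\subseteq N, |S|\leq k\}$ (i.e. $|S_k|\le k$ and $f(S_k)\geq \frac12(1-e^{-2})\max\{f(S):|S|\le k\}$), and it uses $O(kn)$ value-oracle queries.
   Context: For $S\subseteq N$ and $u\in N$, $S+u=S\cup\{u\}$, $S-u=S\setminus\{u\}$, $\bar S=N\setminus S$, $f(u\mid S)=f(S+u)-f(S)$. $f$ is symmetric if $f(S)=f(\bar S)$ for all $S\subseteq N$; submodular if $f(S)+f(T)\ge f(S\cup T)+f(S\cap T)$ for all $S,T$. The query complexity is the number of evaluations of $f$. The procedure \textsc{Delete}$(S)$ visits the elements $u$ of the input set $S$ one by one in arbitrary order, and for each visited $u$, if $f(u\mid S-u)<0$ for the current set $S$, it sets $S\gets S-u$; it returns the final set $S$. *)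

(* Defs.v *)
From HB Require Import structures.
From mathcomp Require Import all_boot all_order all_algebra.
From mathcomp Require Import reals.

Set Implicit Arguments.
Unset Strict Implicit.
Unset Printing Implicit Defensive.

Import Order.TTheory GRing.Theory Num.Theory.
Local Open Scope ring_scope.

Definition nonnegative (R : realType) (N : finType) (f : {set N} -> R) : Prop :=
  forall S : {set N}, 0 <= f S.

Definition symmetric_set_fun (R : realType) (N : finType)
    (f : {set N} -> R) : Prop :=
  forall S : {set N}, f S = f (~: S).

Definition submodular (R : realType) (N : finType)
    (f : {set N} -> R) : Prop :=
  forall S T : {set N}, f (S :|: T) + f (S :&: T) <= f S + f T.

(* The empty set is feasible and is used as the default value of the iterated
   max, so this is the maximum of [f S] over the feasible sets [S]. *)
Definition opt (R : realType) (N : finType) (f : {set N} -> R) (k : nat) : R :=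
  \big[Num.max/f set0]_(S : {set N} | (#|S| <= k)%N) f S.

(* Nondeterministic programs over a value oracle {set N} -> R, as decision
   trees.  A program does not take [f] as an argument: its only access to [f]
   is through [Query] nodes.  [Choose P c] continues with [c x] for an arbitrary
   [x] satisfying [P], and is stuck if there is none; it models the unspecified
   choices of an algorithm (ties, visiting orders). *)
Inductive prog (R : realType) (N : finType) (A : Type) : Type :=
| Ret (a : A)
| Query (Q : {set N}) (c : R -> prog R N A)
| Choose (X : Type) (P : X -> Prop) (c : X -> prog R N A).

Arguments Ret {R N A} a.
Arguments Query {R N A} Q c.
Arguments Choose {R N A X} P c.

Fixpoint bind (R : realType) (N : finType) (A B : Type)
    (p : prog R N A) (g : A -> prog R N B) : prog R N B :=
  match p with
  | Ret a => g a
  | Query Q c => Query Q (fun y => bind (c y) g)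
  | Choose X P c => Choose P (fun x => bind (c x) g)
  end.

(* [run f p a q]: with the oracle answering according to [f], some resolution
   of the choices of [p] makes it return [a] after exactly [q] queries. *)
Inductive run (R : realType) (N : finType) (A : Type) (f : {set N} -> R) :
    prog R N A -> A -> nat -> Prop :=
| run_ret a : run f (Ret a) a 0
| run_query Q c a q : run f (c (f Q)) a q -> run f (Query Q c) a q.+1
| run_choose X (P : X -> Prop) c x a q :
    P x -> run f (c x) a q -> run f (Choose P c) a q.

(* f(u | S) = f(S + u) - f(S); every evaluation costs two queries, as no
   oracle answer is cached. *)
Definition marginal (R : realType) (N : finType) (u : N) (S : {set N}) :
    prog R N R :=
  Query (u |: S) (fun y1 => Query S (fun y0 => Ret (y1 - y0))).

Fixpoint marginals (R : realType) (N : finType) (S : {set N}) (us : seq N) :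
    prog R N (seq (N * R)) :=
  if us is u :: us' then
    bind (marginal R u S) (fun m =>
    bind (marginals R S us') (fun ms => Ret ((u, m) :: ms)))
  else Ret [::].

Definition is_max_entry (R : realType) (N : finType)
    (ms : seq (N * R)) (um : N * R) : Prop :=
  um \in ms /\ forall vm, vm \in ms -> vm.2 <= um.2.

Definition choose_argmax (R : realType) (N : finType) (S : {set N}) :
    prog R N N :=
  bind (marginals R S (enum N)) (fun ms =>
  Choose (is_max_entry ms) (fun um => Ret um.1)).

Fixpoint delete_in_order (R : realType) (N : finType) (us : seq N)
    (S : {set N}) : prog R N {set N} :=
  if us is u :: us' then
    bind (marginal R u (S :\ u)) (fun m =>
    delete_in_order R us' (if m < 0 then S :\ u else S))
  else Ret S.

Definition delete (R : realType) (N : finType) (S : {set N}) :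
    prog R N {set N} :=
  Choose (fun us : seq N => perm_eq us (enum S))
         (fun us => delete_in_order R us S).

(* The set S_i computed by the first [i] iterations; the algorithm with
   cardinality bound [k] returns S_k. *)
Fixpoint greedy_cardinality (R : realType) (N : finType) (i : nat) :
    prog R N {set N} :=
  if i is i'.+1 then
    bind (greedy_cardinality R N i') (fun S =>
    bind (choose_argmax R S) (fun u =>
    delete R (u |: S)))
  else Ret set0.

(* Main.v *)
(** Write [m] for the largest marginal at a set [S] none of whose elements has a
    negative marginal, so that [f T <= f S] for all [T] included in [S].  For a
    feasible [T], submodularity applied to [T :|: S] and [T :|: ~: S], together
    with the symmetry [f (T :|: ~: S) = f (S :\: T) <= f S], gives
    [f T <= f (T :|: S) + f S <= 2 * f S + k * m].  Hence each iteration
    multiplies [f T / 2 - f S] by at most [1 - 2 / k], and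
    [(1 - 2 / k) ^+ k <= expR (- 2)].  When [k = 1] this factor is negative, but
    then [f T <= f S_0 + f S_1] and [f S_0 <= f S_1] give [f T <= 2 * f S_1]. *)
Require Import Defs.
From HB Require Import structures.
From mathcomp Require Import all_boot all_order all_algebra.
From mathcomp Require Import reals sequences exp.
From mathcomp Require Import zify lra.

Set Implicit Arguments.
Unset Strict Implicit.
Unset Printing Implicit Defensive.

Import Order.TTheory GRing.Theory Num.Theory.
Local Open Scope ring_scope.

(** * Inversion, composition and existence of runs, with exact query counts *)

Section Runs.
Context {R : realType} {N : finType} {f : {set N} -> R}.

(* Stated by matching on the program because [inversion] on [run] would leave
   equalities of dependent pairs in the [Choose] case. *)
Lemma run_inv A (p : prog R N A) a q : run f p a q ->
  match p with
  | Ret b => a = b /\ q = 0%N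
  | Query Q c => exists2 q', q = q'.+1 & run f (c (f Q)) a q'
  | Choose X P c => exists2 x, P x & run f (c x) a q
  end.
Proof.
case=> [//|Q c {}a {}q H|X P c x {}a {}q Px H]; first by exists q.
by exists x.
Qed.

Lemma run_ret_inv {A} {b a : A} {q} : run f (Ret b) a q -> a = b /\ q = 0%N.
Proof. exact: run_inv. Qed.

Lemma run_query_inv {A Q} {c : R -> prog R N A} {a q} :
  run f (Query Q c) a q -> exists2 q', q = q'.+1 & run f (c (f Q)) a q'.
Proof. exact: run_inv. Qed.

Lemma run_choose_inv {A X} {P : X -> Prop} {c : X -> prog R N A} {a q} :
  run f (Choose P c) a q -> exists2 x, P x & run f (c x) a q.
Proof. exact: run_inv. Qed.

Lemma run_bind A B (p : prog R N A) (g : A -> prog R N B) a b q1 q2 :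
  run f p a q1 -> run f (g a) b q2 -> run f (bind p g) b (q1 + q2).
Proof.
elim=> {p a q1} [a|Q c a q _ IH|X P c x a q Px _ IH] Hg //=.
  by apply: run_query; apply: IH.
by apply: run_choose Px _; apply: IH.
Qed.

Lemma run_bind_inv {A B} {p : prog R N A} {g : A -> prog R N B} {b q} :
  run f (bind p g) b q ->
  exists a q1 q2, [/\ run f p a q1, run f (g a) b q2 & q = (q1 + q2)%N].
Proof.
elim: p q => [a|Q c IH|X P c IH] q /=.
- by move=> H; exists a, 0%N, q; split=> //; apply: run_ret.
- case/run_query_inv=> q' -> /IH[a [q1 [q2 [H1 H2 ->]]]].
  by exists a, q1.+1, q2; split=> //; apply: run_query.
- case/run_choose_inv=> x Px /IH[a [q1 [q2 [H1 H2 ->]]]].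
  by exists a, q1, q2; split=> //; apply: run_choose Px _.
Qed.

#[local] Arguments bind : simpl never.

Lemma run_marginal u S : run f (marginal R u S) (f (u |: S) - f S) 2.
Proof. by do 2!apply: run_query; apply: run_ret. Qed.

Lemma run_marginal_inv u S m q :
  run f (marginal R u S) m q -> m = f (u |: S) - f S /\ q = 2%N.
Proof.
by case/run_query_inv=> q1 -> /run_query_inv[q2 -> /run_ret_inv[-> ->]].
Qed.

Lemma run_marginals S us :
  run f (marginals R S us) [seq (u, f (u |: S) - f S) | u <- us] (2 * size us).
Proof.
elim: us => [|u us IH] /=; first exact: run_ret.
rewrite mulnS; apply: run_bind (run_marginal u S) _.
by rewrite -[(2 * _)%N]addn0; apply: run_bind IH _; apply: run_ret.
Qed.

Lemma run_marginals_inv S us ms q :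
  run f (marginals R S us) ms q ->
  ms = [seq (u, f (u |: S) - f S) | u <- us] /\ q = (2 * size us)%N.
Proof.
elim: us ms q => [|u us IH] ms q /=; first by case/run_ret_inv.
case/run_bind_inv=> m [q1 [q2 [/run_marginal_inv[-> ->] + ->]]].
case/run_bind_inv=> ms' [q3 [q4 [/IH[-> ->] /run_ret_inv[-> ->] ->]]].
by rewrite addn0 mulnS.
Qed.

Lemma run_choose_argmax_inv S u q :
  run f (choose_argmax R S) u q ->
  (forall v, f (v |: S) <= f (u |: S)) /\ q = (2 * #|N|)%N.
Proof.
case/run_bind_inv=> ms [q1 [q2 [/run_marginals_inv[-> ->] + ->]]].
case/run_choose_inv=> _ [/mapP[w _ ->] max_w] /run_ret_inv[-> ->] /=.
split=> [v|]; last by rewrite addn0 cardE.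
have /max_w /= : (v, f (v |: S) - f S) \in
    [seq (u, f (u |: S) - f S) | u <- enum N].
  by apply: map_f; rewrite mem_enum.
(* All marginals at [S] share the term [- f S], so comparing them amounts to comparing the values
   [f (v |: S)]. *)
by rewrite lerD2r.
Qed.

Lemma choose_argmax_runs S : (0 < #|N|)%N ->
  exists u q, run f (choose_argmax R S) u q.
Proof.
case/card_gt0P=> u0 _.
case: (@arg_maxP _ R N u0 xpredT (fun u => f (u |: S)) isT) => u _ max_u.
exists u, (2 * size (enum N) + 0)%N.
apply: run_bind (run_marginals _ _) _.
apply: (@run_choose _ _ _ _ _ _ _ (u, f (u |: S) - f S)); last exact: run_ret.
split; first by apply: map_f; rewrite mem_enum.
by move=> _ /mapP[v _ ->] /=; rewrite lerD2r; apply: max_u.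
Qed.

Lemma delete_in_order_runs us S :
  exists S' q, run f (delete_in_order R us S) S' q.
Proof.
elim: us S => [|u us IH] S /=; first by exists S, 0%N; apply: run_ret.
set m := f (u |: S :\ u) - f (S :\ u).
have [S' [q H]] := IH (if m < 0 then S :\ u else S).
by exists S', (2 + q)%N; apply: run_bind (run_marginal _ _) H.
Qed.

(** Keeps the guarantee on all runs from being vacuous. On an empty ground set the argmax choice has
    no candidate and the program is stuck. *)
Lemma greedy_cardinality_runs k : (0 < #|N|)%N ->
  exists S q, run f (greedy_cardinality R N k) S q.
Proof.
move=> N_gt0; elim: k => [|k [S [q1 H1]]] /=.
  by exists set0, 0%N; apply: run_ret.
have [u [q2 H2]] := choose_argmax_runs S N_gt0.
have [S' [q3 H3]] := delete_in_order_runs (enum (u |: S)) (u |: S).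
exists S', (q1 + (q2 + q3))%N; apply: run_bind H1 (run_bind H2 _).
exact: (@run_choose _ _ _ _ _ _ _ (enum (u |: S)) _ _ (perm_refl _) H3).
Qed.

End Runs.

#[local] Arguments bind : simpl never.

(** * Diminishing returns, and the sets produced by deletion *)

Section SubmodularFunctions.
Variables (R : realType) (N : finType) (f : {set N} -> R).
Hypothesis f_sub : submodular f.

Definition removal_stable (S : {set N}) :=
  forall u, u \in S -> f (S :\ u) <= f S.

(** Diminishing returns: the sets [S :\ u] and [T] have union [S] and intersection [T :\ u]. *)
Lemma le_removal_sub (S T : {set N}) u :
  T \subset S -> u \in T -> f (S :\ u) <= f S -> f (T :\ u) <= f T.
Proof.
move=> TS uT le_u; have := f_sub (S :\ u) T.
have -> : S :\ u :|: T = S.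
  apply/setP=> x; rewrite !inE; have /implyP := subsetP TS x.
  by case: eqP uT => [-> ->|_ _] /=; case: (_ \in T); case: (_ \in S).
have -> : (S :\ u) :&: T = T :\ u.
  by rewrite setIDAC (setIidPr TS).
lra.
Qed.

(** Grow [T] to [S] one element at a time. By [le_removal_sub] each added element has a nonnegative
    marginal, since it has one at the end, in [S]. *)
Lemma removal_stable_le (S T : {set N}) :
  removal_stable S -> T \subset S -> f T <= f S.
Proof.
move=> stS; move Dn: #|S :\: T| => n.
elim: n T Dn => [|n IH] T Dn TS.
  suff -> : S = T by [].
  by apply/eqP; rewrite eqEsubset TS andbT -setD_eq0 -cards_eq0 Dn.
have /card_gt0P[u] : (0 < #|S :\: T|)%N by rewrite Dn.
rewrite inE => /andP[uT uS].
have uTS : u |: T \subset S by rewrite subUset sub1set uS.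
have le_uT : f T <= f (u |: T).
  rewrite -[X in f X](setU1K uT).
  by apply: le_removal_sub uTS _ (stS _ uS); rewrite setU11.
apply: le_trans le_uT (IH _ _ uTS).
have := cardsD1 u (S :\: T).
by rewrite Dn !inE uT uS setDDl setUC => -[].
Qed.

Lemma le_setU_marginal (S T : {set N}) m :
  (forall u, f (u |: S) <= f S + m) -> f (S :|: T) <= f S + m *+ #|T|.
Proof.
move=> le_m; move Dn: #|T| => n; elim: n T Dn => [|n IH] T Dn.
  by rewrite (cards0_eq Dn) setU0 mulr0n addr0.
have /card_gt0P[u uT] : (0 < #|T|)%N by rewrite Dn.
have /IH le_IH : #|T :\ u| = n by move: Dn; rewrite (cardsD1 u) uT => -[].
(* As [u] is not in [T :\ u], these two sets meet exactly in [S], so adding [u] last gains no more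
   than adding it to [S]. *)
have := f_sub (S :|: T :\ u) (u |: S).
have -> : S :|: T :\ u :|: (u |: S) = S :|: T.
  by rewrite (setUC [set u]) setUACA setUid (setUC (T :\ u)) setD1K.
have -> : (S :|: T :\ u) :&: (u |: S) = S.
  apply/setP=> x; rewrite !inE.
  by case: eqP => _; case: (x \in S); rewrite ?andbF ?orbF.
have := le_m u; rewrite mulrS; lra.
Qed.

(** One pass suffices: later deletions only shrink the set, and by [le_removal_sub] an element kept
    when visited stays worth keeping in every smaller set that contains it. *)
Lemma run_delete_in_order_inv us (S S' : {set N}) q :
  run f (delete_in_order R us S) S' q ->
  [/\ S' \subset S, f S <= f S', q = (2 * size us)%N
    & forall u, u \in us -> u \in S' -> f (S' :\ u) <= f S'].
Proof.
elim: us S q => [|v us IH] S q /=; first by case/run_ret_inv=> -> ->; split.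
case/run_bind_inv=> m [q1 [q2 [/run_marginal_inv[-> ->] + ->]]].
rewrite subr_lt0; case: ltP => le_v /IH[sS' leS' -> stS'].
  split.
  - exact: subset_trans sS' (subD1set _ _).
  (* The list is arbitrary here, so [v] may lie outside [S]; its removal then changes nothing. *)
  - apply: le_trans leS'; have [vS|vS] := boolP (v \in S).
      by rewrite -[X in f X](setD1K vS) ltW.
    suff -> : S :\ v = S by [].
    by apply/setDidPl; rewrite disjoint_sym disjoints1.
  - by rewrite mulnS.
  - move=> u; rewrite inE => /orP[/eqP-> vS'|]; last exact: stS'.
    by have := subsetP sS' _ vS'; rewrite !inE eqxx.
split=> //; first by rewrite mulnS.
move=> u; rewrite inE => /orP[/eqP-> vS'|]; last exact: stS'.
have vS := subsetP sS' _ vS'.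
by apply: le_removal_sub sS' vS' _; rewrite -[X in _ <= f X](setD1K vS).
Qed.

Lemma run_delete_inv (S S' : {set N}) q :
  run f (delete R S) S' q ->
  [/\ S' \subset S, f S <= f S', removal_stable S' & q = (2 * #|S|)%N].
Proof.
case/run_choose_inv=> us perm_us /run_delete_in_order_inv[sS' leS' -> stS'].
split=> //; last by rewrite (perm_size perm_us) cardE.
move=> u uS'; apply: stS' (uS').
by rewrite (perm_mem perm_us) mem_enum (subsetP sS').
Qed.

End SubmodularFunctions.

(** * Gain per iteration and the approximation ratio *)

Section Approximation.
Variables (R : realType) (N : finType) (f : {set N} -> R).
Hypotheses (f_ge0 : nonnegative f) (f_sym : symmetric_set_fun f).
Hypothesis f_sub : submodular f.

(** Apply submodularity to [S] and its complement: by symmetry both sides become doubled values. *)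
Lemma symmetric_submodular_set0_le (S : {set N}) : f set0 <= f S.
Proof.
have := f_sub S (~: S).
rewrite setUCr setICr -(f_sym S) -setC0 -f_sym; lra.
Qed.

Lemma removal_stable_gain (S T : {set N}) m :
  removal_stable f S -> (forall u, f (u |: S) <= f S + m) ->
  f T <= 2 * f S + m *+ #|T|.
Proof.
move=> stS le_m; have := f_sub (T :|: S) (T :|: ~: S).
rewrite -setUIr setICr setU0.
have le_compl : f (T :|: ~: S) <= f S.
  rewrite f_sym setCU setCK; apply: removal_stable_le => //.
  exact: subsetIr.
have := le_setU_marginal f_sub T le_m; rewrite setUC.
(* Nonnegativity discards the union term of the submodular inequality. *)
have := f_ge0 (T :|: S :|: (T :|: ~: S)); lra.
Qed.

(** The argmax ranges over all of [N], so a member of [S] competes with marginal zero; the empty set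
    minimizes [f]. Hence the best marginal is nonnegative, which later allows replacing [#|T|] by
    [k]. *)
Lemma removal_stable_argmax_ge (S : {set N}) u :
  (forall v, f (v |: S) <= f (u |: S)) -> f S <= f (u |: S).
Proof.
move=> max_u; have [->|[v vS]] := set_0Vmem S.
  exact: symmetric_submodular_set0_le.
by have := max_u v; rewrite (setUidPr _) // sub1set.
Qed.

Lemma run_greedy_cardinality_step i S' q :
  run f (greedy_cardinality R N i.+1) S' q ->
  exists S q' u, [/\ run f (greedy_cardinality R N i) S q',
    forall v, f (v |: S) <= f (u |: S),
    S' \subset u |: S, f (u |: S) <= f S'
    & removal_stable f S' /\ (q <= q' + 4 * #|N|)%N].
Proof.
case/run_bind_inv=> S [q1 [q2 [H1 + ->]]].
case/run_bind_inv=> u [q3 [q4 [/run_choose_argmax_inv[max_u ->] + ->]]].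
case/(run_delete_inv f_sub)=> sS' leS' stS' ->.
exists S, q1, u; split=> //; split=> //.
(* At two queries per marginal, the argmax costs [2 * #|N|] and the deletion at most as much. *)
have : (#|u |: S| <= #|N|)%N := max_card _; lia.
Qed.

Lemma run_greedy_cardinality_inv i S q :
  run f (greedy_cardinality R N i) S q ->
  [/\ (#|S| <= i)%N, removal_stable f S & (q <= 4 * (i * #|N|))%N].
Proof.
elim: i S q => [|i IH] S q.
  by case/run_ret_inv=> -> ->; split; rewrite ?cards0 // => u; rewrite inE.
case/run_greedy_cardinality_step=> S0 [q0 [u [/IH[cS0 _ leq0]]]].
move=> _ sS _ [stS leq]; split=> //; last by lia.
apply: leq_trans (subset_leq_card sS) _.
by rewrite cardsU1; case: (_ \notin _) => /=; lia.
Qed.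

Lemma run_greedy_cardinality_gain i S' q :
  run f (greedy_cardinality R N i.+1) S' q ->
  exists S q', [/\ run f (greedy_cardinality R N i) S q', f S <= f S'
    & forall k (T : {set N}), (#|T| <= k)%N ->
        f T <= 2 * f S + k%:R * (f S' - f S)].
Proof.
case/run_greedy_cardinality_step=> S [q' [u [H max_u _ leS' _]]].
have leS := removal_stable_argmax_ge max_u.
have [_ stS _] := run_greedy_cardinality_inv H.
exists S, q'; split=> //; first exact: le_trans leS leS'.
move=> k T cT.
(* Deletion never decreases [f], so the net gain of the iteration bounds every marginal at [S]. *)
apply: le_trans (removal_stable_gain T stS (m := f S' - f S) _) _.
  by move=> v; rewrite subrKC; apply: le_trans (max_u v) leS'.
rewrite lerD2l -[_ *+ #|T|]mulr_natl ler_wpM2r ?ler_nat // subr_ge0.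
exact: le_trans leS leS'.
Qed.

Lemma greedy_cardinality_gap k i (T : {set N}) S q :
  (1 < k)%N -> (#|T| <= k)%N -> run f (greedy_cardinality R N i) S q ->
  f T / 2 - f S <= (1 - 2 / k%:R) ^+ i * (f T / 2).
Proof.
move=> k_gt1 cT; have k_ge2 : 2 <= k%:R :> R by rewrite ler_nat.
have k_gt0 : 0 < k%:R :> R by lra.
elim: i S q => [|i IH] S q.
  by move=> _; rewrite expr0 mul1r; have := f_ge0 S; lra.
case/run_greedy_cardinality_gain=> S0 [q0 [/IH le_IH _ /(_ _ _ cT) gain]].
(* This sign, which requires [k] to be at least 2, lets the induction hypothesis be multiplied by
   the factor. *)
have r_ge0 : 0 <= 1 - 2 / k%:R :> R by rewrite subr_ge0 ler_pdivrMr ?mul1r.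
rewrite exprS -mulrA; apply: le_trans (ler_wpM2l r_ge0 le_IH).
have kr : k%:R * (1 - 2 / k%:R) = k%:R - 2 :> R.
  by rewrite mulrBr mulr1 mulrC divfK ?gt_eqF.
by rewrite -(ler_pM2l k_gt0) mulrA kr; lra.
Qed.

(** The bound [1 + x <= expR x] at [x = - (2 / k)], raised to the power [k]; the base is nonnegative
    since [k] is at least 2. *)
Lemma expr_1B2k_le (k : nat) : (1 < k)%N ->
  (1 - 2 / k%:R) ^+ k <= expR (- 2) :> R.
Proof.
move=> k_gt1; have k_gt0 : 0 < k%:R :> R by rewrite ltr0n; lia.
have r_ge0 : 0 <= 1 - 2 / k%:R :> R.
  by rewrite subr_ge0 ler_pdivrMr // mul1r ler_nat.
have -> : - 2 = k%:R * - (2 / k%:R) :> R.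
  by rewrite mulrN mulrC divfK ?gt_eqF.
by rewrite expRM_natl lerXn2r ?nnegrE ?expR_ge0 ?expR_ge1Dx.
Qed.

Lemma greedy_cardinality_approx k (T : {set N}) S q :
  (0 < k)%N -> (#|T| <= k)%N -> run f (greedy_cardinality R N k) S q ->
  2^-1 * (1 - expR (- 2)) * f T <= f S.
Proof.
move=> k_gt0 cT; have T_ge0 := f_ge0 T; have [k1|] := leqP k 1.
  have {k1 k_gt0 cT} [-> cT] : k = 1%N /\ (#|T| <= 1)%N by lia.
  case/run_greedy_cardinality_gain=> S0 [q0 [_ leS /(_ _ _ cT)]].
  rewrite mul1r => gain.
  have := mulr_ge0 (expR_ge0 (- 2)) T_ge0; lra.
move=> k_gt1 /(greedy_cardinality_gap k_gt1 cT) gap.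
have := ler_wpM2r T_ge0 (expr_1B2k_le k_gt1); lra.
Qed.

End Approximation.

Lemma opt_attained (R : realType) (N : finType) (f : {set N} -> R) (k : nat) :
  exists2 T : {set N}, (#|T| <= k)%N & opt f k = f T.
Proof.
rewrite /opt.
apply: (big_ind (fun x => exists2 T : {set N}, (#|T| <= k)%N & x = f T)).
(* The default value of the iterated max is attained at the feasible set [set0]. *)
- by exists set0; rewrite ?cards0.
- by move=> x y; case: leP.
- by move=> T cT; exists T.
Qed.

Theorem theorem1 :
  exists C : nat,
  forall (R : realType) (N : finType) (f : {set N} -> R) (k : nat),
    nonnegative f -> symmetric_set_fun f -> submodular f -> (0 < k)%N ->
    ((0 < #|N|)%N ->
       exists (S : {set N}) (q : nat), run f (greedy_cardinality R N k) S q) /\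
    (forall (S : {set N}) (q : nat),
       run f (greedy_cardinality R N k) S q ->
       [/\ (#|S| <= k)%N,
           2^-1 * (1 - expR (- 2)) * opt f k <= f S
         & (q <= C * (k * #|N|))%N]).
Proof.
exists 4%N => R N f k f_ge0 f_sym f_sub k_gt0.
split=> [|S q runS]; first exact: greedy_cardinality_runs.
have [cS _ leq] := run_greedy_cardinality_inv f_sub runS.
have [T cT ->] := opt_attained f k.
by split=> //; apply: greedy_cardinality_approx runS.
Qed.
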